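(* Let $n>1$ be a positive integer, $q$ a prime power and $g(x)\in\mathbb{F}_q[x]$. Then the polynomial $$f(x)=x^q-x+g(\mathrm{Tr}(x)),\qquad \mathrm{Tr}(x)=x+x^q+\cdots+x^{q^{n-1}},$$ is a permutation polynomial of $\mathbb{F}_{q^n}$ if and only if $\gcd(n,q)=1$ and $g(x)$ is a permutation polynomial of $\mathbb{F}_q$. Moreover, if $f(x)$ is a permutation polynomial of $\mathbb{F}_{q^n}$ and $g^{-1}(x)$ is the compositional inverse of $g(x)$ over $\mathbb{F}_q$, then $$f^{-1}(x)=\frac1n\left(g^{-1}\bigl(\mathrm{Tr}(x)/n\bigr)-\frac{n(n+1)}{2}\cdot\frac{\mathrm{Tr}(x)}{n}+\sum_{i=1}^{n}i\,x^{q^{i-1}}\right),$$ where $\frac{n(n+1)}{2}$ is the integer $1+2+\cdots+n$ viewed in $\mathbb{F}_q$ (so the middle term is $-\frac{n+1}{2}\mathrm{Tr}(x)$).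
   Context: $\mathbb{F}_q$ is the finite field with $q$ elements. A polynomial over a finite field $K$ is a permutation polynomial of $K$ if it induces a bijection $K\to K$; its compositional inverse (over $K$) is a polynomial inducing the inverse map. Polynomials over $\mathbb{F}_{q^n}$ are considered as functions on $\mathbb{F}_{q^n}$, i.e. modulo $x^{q^n}-x$, and the formula for $f^{-1}$ is an equality of functions on $\mathbb{F}_{q^n}$. $\mathrm{Tr}$ is the trace map from $\mathbb{F}_{q^n}$ to $\mathbb{F}_q$. *)

(* Defs.v *)
From HB Require Import structures.
From mathcomp Require Import all_boot all_order all_algebra all_field.

Set Implicit Arguments.
Unset Strict Implicit.
Unset Printing Implicit Defensive.

Import GRing.Theory.
Local Open Scope ring_scope.

Definition permutation_poly (K : finFieldType) (f : {poly K}) : Prop :=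
  bijective (fun x : K => f.[x]).

(* The compositional inverse of [f] over [K] is only determined modulo
   ['X^#|K| - 'X], hence a relation on polynomials and not an operation. *)
Definition compositional_inverse (K : finFieldType) (f h : {poly K}) : Prop :=
  cancel (fun x : K => f.[x]) (fun x : K => h.[x]) /\
  cancel (fun x : K => h.[x]) (fun x : K => f.[x]).

Definition trace_poly (L : finFieldType) (q n : nat) : {poly L} :=
  \sum_(0 <= i < n) 'X^(q ^ i).

(* Coefficients in the small field [F] are viewed in [L] through [iota]. *)
Definition f_poly (F L : finFieldType) (iota : {rmorphism F -> L})
    (q n : nat) (g : {poly F}) : {poly L} :=
  'X^q - 'X + (map_poly iota g \Po trace_poly L q n).

Definition f_inv_poly (F L : finFieldType) (iota : {rmorphism F -> L})
    (q n : nat) (ginv : {poly F}) : {poly L} :=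
  let Tr_n := (n%:R : L)^-1 *: trace_poly L q n in
  (n%:R : L)^-1 *:
    ((map_poly iota ginv \Po Tr_n)
     - ((n * (n + 1)) %/ 2)%:R *: Tr_n
     + \sum_(1 <= i < n.+1) i%:R *: 'X^(q ^ (i - 1))).

(* Main.v *)
Require Import Defs.
From HB Require Import structures.
From mathcomp Require Import all_boot all_order all_fingroup all_algebra.
From mathcomp Require Import all_solvable all_field ring.

Set Implicit Arguments.
Unset Strict Implicit.
Unset Printing Implicit Defensive.

Import GRing.Theory.
Local Open Scope ring_scope.

(** Write [T x] for the trace.  Two facts drive everything: [T] kills
    [x ^+ q - x] and multiplies the elements of the small field by [n].  As
    [g (T x)] lies in the small field, [T (f x) = n * g (T x)]
    ([trace_f_poly]).

    If [f] is a permutation and [n = 0] in the field, this makes the trace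
    vanish on the image of [f], that is everywhere, although its polynomial has
    degree [q ^ n.-1 < q ^ n] ([trace_neq0]).  So [n] is invertible, and
    preimages under [f] of elements [b] of the small field give
    [g (T x) = b], so that [g] is onto.

    Conversely, let [n] be invertible and [g] injective.  From [f x = f y] one
    gets [T x = T y], hence [x ^+ q - y ^+ q = x - y]: the difference [x - y]
    lies in the small field and has trace [n * (x - y) = 0].

    For the inverse, [T (f x) / n = g (T x)] lets [g^-1] recover [T x], and
    Abel summation of [\sum_i i * (f x) ^+ (q ^ (i - 1))] telescopes to
    [n * x - T x] plus a multiple of [g (T x)] ([weighted_conj_sum_f_poly]);
    the correction terms in the formula cancel everything but [n * x]. *)

(** Summation by parts against the weights [1, 2, ..]; for [a i] the conjugates
    of [x] the sum turns into [n * x] minus the trace. *)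
Lemma abel_sum (R : comPzRingType) (m : nat) (a : nat -> R) :
  \sum_(0 <= i < m) i.+1%:R * (a i.+1 - a i)
  = m%:R * a m - \sum_(0 <= i < m) a i.
Proof.
elim: m => [|m IHm]; first by rewrite !big_nil mul0r subr0.
by rewrite !big_nat_recr //= IHm; ring.
Qed.

Lemma card_pchar_pnat (K : finFieldType) (p : nat) :
  p \in [pchar K] -> p.-nat #|K|.
Proof.
by move=> /fin_ring_pchar_abelem/abelem_pgroup; rewrite /pgroup cardsT.
Qed.

Section Extension.

Variables (n q : nat) (F L : finFieldType) (iota : {rmorphism F -> L}).
Hypotheses (hF : #|F| = q) (hL : #|L| = (q ^ n)%N).

Let q_gt1 : (1 < q)%N.
Proof. by rewrite -hF card_finRing_gt1. Qed.

Lemma expr_subfield (i : nat) (c : F) : iota c ^+ (q ^ i) = iota c.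
Proof.
elim: i => [|i IHi]; first by rewrite expr1.
by rewrite expnS exprM -[iota c ^+ q]rmorphXn -hF expf_card hF.
Qed.

Lemma card_pnat_pchar : [pchar L].-nat q.
Proof.
have [p p_pr pF] := finPcharP F.
have pq : p.-nat q by rewrite -hF card_pchar_pnat.
have pL : p \in [pchar L] by rewrite (fmorph_pchar iota).
by apply: sub_in_pnat pq => r _ /eqP->.
Qed.

Lemma exprD_card (i : nat) (x y : L) :
  (x + y) ^+ (q ^ i) = x ^+ (q ^ i) + y ^+ (q ^ i).
Proof. by rewrite exprDn_pchar // pnatX card_pnat_pchar. Qed.

Lemma exprB_card (i : nat) (x y : L) :
  (x - y) ^+ (q ^ i) = x ^+ (q ^ i) - y ^+ (q ^ i).
Proof. by apply/eqP; rewrite eq_sym subr_eq -exprD_card subrK. Qed.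

(** The image of the small field already supplies [q] roots of ['X^q - 'X],
    which is as many as its degree permits. *)
Lemma fixed_in_subfield (x : L) : x ^+ q = x -> exists c : F, x = iota c.
Proof.
move=> xq; case: (pickP (fun c => iota c == x)) => [c /eqP<-|nox].
  by exists c.
pose P : {poly L} := 'X^q - 'X.
have size_P : size P = q.+1.
  by rewrite size_polyDl ?size_polyXn // size_polyN size_polyX.
have P0 : P != 0 by rewrite -size_poly_eq0 size_P.
suff: (size (x :: map iota (enum F)) < size P)%N.
  by rewrite size_P /= size_map -cardT hF ltnn.
apply: max_poly_roots P0 _ _.
  rewrite /= rootE !hornerE xq subrr eqxx /=; apply/allP => _ /mapP[c _ ->].
  by have := expr_subfield 1 c; rewrite rootE !hornerE => ->; rewrite subrr.
rewrite /= map_inj_uniq ?enum_uniq ?andbT; last exact: fmorph_inj.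
by apply/mapP => -[c _ xc]; have := nox c; rewrite xc eqxx.
Qed.

Lemma coprime_card_natr_neq0 : coprime n q = (n%:R != 0 :> L).
Proof.
have [p p_pr pF] := finPcharP F.
have pL : p \in [pchar L] by rewrite (fmorph_pchar iota).
have : p.-nat q by rewrite -hF card_pchar_pnat.
case/p_natP => -[|k] qE; first by have := q_gt1; rewrite qE.
by rewrite -(dvdn_pcharf pL) -prime_coprime // qE coprime_pexpr // coprime_sym.
Qed.

Local Notation Tr x := (trace_poly L q n).[x].

Lemma horner_trace (x : L) : Tr x = \sum_(0 <= i < n) x ^+ (q ^ i).
Proof.
by rewrite horner_sum; apply: eq_bigr => i _; rewrite hornerXn.
Qed.

Lemma traceD (x y : L) : Tr (x + y) = Tr x + Tr y.
Proof.
by rewrite !horner_trace -big_split; apply: eq_bigr => i _; apply: exprD_card.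
Qed.

Lemma traceB (x y : L) : Tr (x - y) = Tr x - Tr y.
Proof. by apply/eqP; rewrite eq_sym subr_eq -traceD subrK. Qed.

Lemma trace_subfield (c : F) : Tr (iota c) = n%:R * iota c.
Proof.
rewrite horner_trace (eq_bigr (fun=> iota c)) => [|i _]; last first.
  exact: expr_subfield.
by rewrite sumr_const_nat subn0 mulr_natl.
Qed.

(** The conjugates telescope, and [x ^+ (q ^ n) = x]. *)
Lemma trace_frobenius_sub (x : L) : Tr (x ^+ q - x) = 0.
Proof.
rewrite horner_trace.
rewrite (eq_bigr (fun i => x ^+ (q ^ i.+1) - x ^+ (q ^ i))) => [|i _].
  by rewrite telescope_sumr // -hL expf_card expr1 subrr.
by rewrite exprB_card -exprM -expnS.
Qed.

Lemma trace_frobenius (x : L) : Tr x ^+ q = Tr x.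
Proof.
suff <- : Tr (x ^+ q) = Tr x ^+ q.
  by apply/eqP; rewrite -subr_eq0 -traceB trace_frobenius_sub.
have q0 : 0 ^+ q = 0 :> L by rewrite expr0n eqn0Ngt ltnW.
have qD : {morph (fun y : L => y ^+ q) : y z / y + z} := exprD_card 1.
rewrite !horner_trace (big_morph _ qD q0).
by apply: eq_bigr => i _; rewrite -!exprM mulnC.
Qed.

Lemma trace_in_subfield (x : L) : exists t : F, Tr x = iota t.
Proof. exact/fixed_in_subfield/trace_frobenius. Qed.

(** A vanishing trace would give its polynomial [q ^ n] roots, more than its
    degree [q ^ n.-1]. *)
Lemma trace_neq0 : (0 < n)%N -> exists x : L, Tr x != 0.
Proof.
move=> n_gt0; case: (pickP (fun x : L => Tr x != 0)) => [x|Tr0].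
  by exists x.
have size_T : size (trace_poly L q n) = (q ^ n.-1).+1.
  rewrite /trace_poly -[in LHS](prednK n_gt0) big_nat_recr //= addrC.
  rewrite size_polyDl ?size_polyXn // ltnS.
  apply: leq_trans (size_sum _ _ _) _; apply/bigmax_leqP_seq => i.
  rewrite mem_index_iota => /andP[_ ltin] _.
  by rewrite size_polyXn ltn_exp2l.
have T0 : trace_poly L q n != 0 by rewrite -size_poly_eq0 size_T.
suff: (size (enum L) < size (trace_poly L q n))%N.
  by rewrite size_T -cardT hL ltnS leq_exp2l // leqNgt ltn_predL n_gt0.
apply: max_poly_roots T0 _ (enum_uniq _).
by apply/allP => x _; have := Tr0 x; rewrite rootE => /negbFE.
Qed.

Lemma horner_f_poly (g : {poly F}) (x : L) (t : F) :
  Tr x = iota t -> (f_poly iota q n g).[x] = x ^+ q - x + iota g.[t].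
Proof. by move=> xt; rewrite !hornerE horner_comp xt horner_map. Qed.

Lemma trace_f_poly (g : {poly F}) (x : L) (t : F) :
  Tr x = iota t -> Tr (f_poly iota q n g).[x] = n%:R * iota g.[t].
Proof.
by move=> /horner_f_poly->; rewrite traceD trace_frobenius_sub add0r
  trace_subfield.
Qed.

(** If [n] is zero, so is the trace on the image of [f]. *)
Lemma f_poly_perm_natr_neq0 (g : {poly F}) :
  (0 < n)%N -> permutation_poly (f_poly iota q n g) -> n%:R != 0 :> L.
Proof.
move=> n_gt0 [h _ fh]; apply/eqP => n0.
have [y] := trace_neq0 n_gt0; rewrite -(fh y).
by have [t /trace_f_poly->] := trace_in_subfield (h y); rewrite n0 mul0r eqxx.
Qed.

(** On preimages of the small field, [trace_f_poly] reads [n * g (T x) = n * b];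
    as the field is finite, a section of [g] is a two-sided inverse. *)
Lemma f_poly_perm_g (g : {poly F}) :
  n%:R != 0 :> L -> permutation_poly (f_poly iota q n g) -> permutation_poly g.
Proof.
move=> n_neq0 [h _ fh].
have g_onto (b : F) : exists t, g.[t] == b.
  have [t ht] := trace_in_subfield (h (iota b)); exists t.
  apply/eqP/(fmorph_inj iota)/(mulfI n_neq0).
  by rewrite -(trace_f_poly g ht) fh trace_subfield.
pose k b := xchoose (g_onto b).
have kK : cancel k (fun t => g.[t]).
  by move=> b; apply/eqP/(xchooseP (g_onto b)).
by exists k => //; apply: canF_sym kK.
Qed.

(** The trace of [f x] determines [T x]; then [f x] determines [x] up to an
    element of the small field, which is seen by the trace as [n] is nonzero. *)
Lemma f_poly_perm (g : {poly F}) :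
  n%:R != 0 :> L -> permutation_poly g -> permutation_poly (f_poly iota q n g).
Proof.
move=> n_neq0 /bij_inj g_inj; apply: injF_bij => x y fxy.
have [[t xt] [u yu]] := (trace_in_subfield x, trace_in_subfield y).
have tu : t = u.
  apply/g_inj/(fmorph_inj iota)/(mulfI n_neq0).
  by rewrite -(trace_f_poly g xt) -(trace_f_poly g yu) fxy.
have [c xyc] : exists c, x - y = iota c.
  apply: fixed_in_subfield; have := exprB_card 1 x y; rewrite expn1 => ->.
  move: fxy; rewrite /= (horner_f_poly g xt) (horner_f_poly g yu) tu.
  by move=> /addIr /eqP; rewrite subr_eq => /eqP->; ring.
have /eqP := trace_subfield c; rewrite -xyc traceB xt yu tu subrr.
by rewrite eq_sym mulf_eq0 (negPf n_neq0) subr_eq0 => /eqP.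
Qed.

(** Up to the constant [g (T x)], which the q-power map fixes, the conjugates of
    [f x] are differences of consecutive conjugates of [x], so [abel_sum]
    applies. *)
Lemma weighted_conj_sum_f_poly (g : {poly F}) (x : L) (t : F) :
  Tr x = iota t ->
  \sum_(1 <= i < n.+1) i%:R * (f_poly iota q n g).[x] ^+ (q ^ (i - 1))
  = n%:R * x - Tr x + ((n * (n + 1)) %/ 2)%:R * iota g.[t].
Proof.
move=> xt; rewrite (horner_f_poly g xt) big_add1 /=.
(* The integer is [1 + .. + n], matching the weights after the index shift. *)
have -> : ((n * (n + 1)) %/ 2)%:R = \sum_(0 <= i < n) i.+1%:R :> L.
  rewrite -natr_sum; congr _%:R.
  by rewrite divn2 addn1 mulnC -bin2 -bin2_sum big_nat_recl // add0n.
rewrite horner_trace mulr_suml.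
rewrite -[X in n%:R * X]expf_card hL -(abel_sum n (fun i => x ^+ (q ^ i))).
rewrite -big_split; apply: eq_bigr => i _ /=.
by rewrite subn1 exprD_card exprB_card expr_subfield -exprM -expnS mulrDr.
Qed.

Lemma f_inv_polyK (g ginv : {poly F}) :
  n%:R != 0 :> L -> cancel (fun t : F => g.[t]) (fun t : F => ginv.[t]) ->
  cancel (fun x : L => (f_poly iota q n g).[x])
         (fun x : L => (f_inv_poly iota q n ginv).[x]).
Proof.
move=> n_neq0 gK x; have [t xt] := trace_in_subfield x.
have := weighted_conj_sum_f_poly g xt; have := trace_f_poly g xt.
move: (_.[x]) => y Ty wy.
rewrite /f_inv_poly hornerZ !hornerD hornerN horner_comp !hornerZ Ty mulKf //.
rewrite horner_map gK horner_sum.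
under eq_bigr => i _ do rewrite hornerZ hornerXn.
by rewrite wy xt; field.
Qed.

End Extension.

Theorem theorem4p2 (n q : nat) (F L : finFieldType)
    (iota : {rmorphism F -> L}) (g : {poly F})
    (hn : (1 < n)%N) (hF : #|F| = q) (hL : #|L| = (q ^ n)%N) :
  (permutation_poly (f_poly iota q n g) <->
     gcdn n q = 1%N /\ permutation_poly g) /\
  (permutation_poly (f_poly iota q n g) ->
     forall ginv : {poly F}, compositional_inverse g ginv ->
       compositional_inverse (f_poly iota q n g) (f_inv_poly iota q n ginv)).
Proof.
have n_gt0 := ltnW hn; have cop := coprime_card_natr_neq0 n iota hF.
split; first split.
- move=> f_perm; have n_neq0 := f_poly_perm_natr_neq0 hF hL n_gt0 f_perm.
  split; first by apply/eqP; rewrite -/(coprime n q) cop.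
  exact (f_poly_perm_g hF hL n_neq0 f_perm).
- case=> /eqP; rewrite -/(coprime n q) cop => n_neq0.
  exact (f_poly_perm iota hF hL n_neq0).
move=> f_perm ginv [gK _].
have n_neq0 := f_poly_perm_natr_neq0 hF hL n_gt0 f_perm.
have fK := f_inv_polyK iota hF hL n_neq0 gK.
by split=> //; apply: canF_sym fK.
Qed.
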